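(* Let $\alpha\vDash n$ and define a reading order on $\mathsf{Rib}(\alpha)$ by reading entries from left to right along rows, starting at the bottom row and proceeding upwards. Then the projective indecomposable $H_n(0)$-module $\mathbf{P}_\alpha$ is precisely the diagram module $\mathbf{N}_{\mathsf{Rib}(\alpha)}$.
   Context: $H_n(0)$ is the $\mathbb{C}$-algebra with generators $\pi_1,\dots,\pi_{n-1}$ and relations $\pi_i^2=-\pi_i$, $\pi_i\pi_j=\pi_j\pi_i$ for $|i-j|\ge2$, $\pi_i\pi_{i+1}\pi_i=\pi_{i+1}\pi_i\pi_{i+1}$. The ribbon diagram of a composition $\alpha\vDash n$ is the diagram whose $i$th row from the bottom consists of $\alpha_i$ boxes, such that the leftmost box in each row is immediately above the rightmost box in the row below. $\mathsf{Rib}(\alpha)$ (standard ribbon tableaux) is the set of standard fillings (bijective assignments of $1,\dots,n$ to the boxes) of the ribbon diagram of $\alpha$ such that entries increase from left to right along rows and from top to bottom in columns. $\mathbf{P}_\alpha$ is (following Huang) the $\mathbb{C}$-span of $\mathsf{Rib}(\alpha)$ with the action: for $T\in\mathsf{Rib}(\alpha)$, $\pi_iT=-T$ if $i$ is strictly above $i+1$ in $T$; $\pi_iT=0$ if $i$ is in the same row as $i+1$; $\pi_iT=s_iT$ if $i$ is strictly below $i+1$, where $s_iT$ exchanges the entries $i$ and $i+1$ of $T$. Diagram modules. Let $D$ be a diagram of $n$ boxes with a reading order (a total order on the boxes); $\mathrm{rw}(T)$ is the permutation given by the entries of $T$ in reading order from left to right. For a nonempty set $\mathcal{T}$ of standard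 fillings of $D$ and $T\in\mathcal{T}$, $\mathrm{Des}(T)$ is the set of $i\in\{1,\dots,n-1\}$ with $i$ to the right of $i+1$ in $\mathrm{rw}(T)$. Elements of $\{1,\dots,n-1\}\setminus\mathrm{Des}(T)$ are ascents; an ascent $i$ is attacking if $s_iT\notin\mathcal{T}$ and nonattacking otherwise. $T$ has an ascent in positions $(r,s)$ if $r<s$ and $\mathrm{rw}(T)_s-\mathrm{rw}(T)_r=1$. $\mathcal{T}$ is ascent-compatible if whenever $T,T'\in\mathcal{T}$ both have an ascent in positions $(r,s)$, it is attacking in $T$ if and only if it is attacking in $T'$. In that case $\mathbf{N}_{\mathcal{T}}$ is the $H_n(0)$-module on the $\mathbb{C}$-span of $\mathcal{T}$ with $\pi_iT=-T$ if $i\in\mathrm{Des}(T)$, $0$ if $i$ is an attacking ascent, $s_iT$ if $i$ is a nonattacking ascent. *)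

(* Defs.v *)
From HB Require Import structures.
From mathcomp Require Import all_boot all_order all_algebra all_fingroup.
From mathcomp Require Import finmap.
From mathcomp Require Import reals.
From mathcomp Require Import complex.

Set Implicit Arguments.
Unset Strict Implicit.
Unset Printing Implicit Defensive.

Import GRing.Theory.
Local Open Scope ring_scope.

(* A module over the algebra presented by pi_1, ..., pi_(n-1) and the 0-Hecke *)
(* relations is a vector space with linear operators satisfying these         *)
(* relations. The space is a subspace [space M] of an ambient space V; the    *)
(* value of [act M i] matters only on [space M] and for 0 < i < n.            *)
Record op_space (F : fieldType) (V : vectType F) := OpSpace {
  space : {vspace V};
  act : nat -> V -> V }.

Record is_H0_module (F : fieldType) (V : vectType F) (n : nat)
    (M : op_space V) : Prop := IsH0Module {
  H0_stable : forall i v, (0 < i < n)%N ->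
    v \in space M -> act M i v \in space M;
  H0_linear : forall i (a : F) u v, (0 < i < n)%N ->
    u \in space M -> v \in space M ->
    act M i (a *: u + v) = a *: act M i u + act M i v;
  H0_quad : forall i v, (0 < i < n)%N -> v \in space M ->
    act M i (act M i v) = - act M i v;
  H0_comm : forall i j v, (0 < i)%N -> (i.+2 <= j)%N -> (j < n)%N ->
    v \in space M ->
    act M i (act M j v) = act M j (act M i v);
  H0_braid : forall i v, (0 < i)%N -> (i.+1 < n)%N -> v \in space M ->
    act M i (act M i.+1 (act M i v)) = act M i.+1 (act M i (act M i.+1 v)) }.

Definition same_H0_module (F : fieldType) (V : vectType F) (n : nat)
    (M M' : op_space V) : Prop :=
  space M = space M' /\
  forall i v, (0 < i < n)%N -> v \in space M -> act M i v = act M' i v.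

(* The box (r, c) lies in row r, counted from the bottom, and in column c,    *)
(* counted from the left.                                                     *)
Definition box : Type := (nat * nat)%type.
Definition box_row (b : box) : nat := b.1.
Definition box_col (b : box) : nat := b.2.

Section Fillings.
Variables (n : nat) (D : {fset (nat * nat)}).

(* Entries are the elements 1, ..., n of 'I_n.+1; the value 0 is excluded by  *)
(* [standard].                                                                *)
Definition filling := {ffun D -> 'I_n.+1}.

Definition standard (T : filling) : bool :=
  injectiveb T && [forall k : 'I_n.+1, (k \in codom T) == (0 < k)%N].

Definition swap (i : nat) (T : filling) : filling :=
  [ffun b => tperm (inord i) (inord i.+1) (T b)].

(* The reading order [le] is a total order on boxes; [rw] is the reading word *)
(* in one-line notation. Positions in it are counted from 0 below.            *)
Definition rw (le : rel box) (T : filling) : seq nat :=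
  [seq val (T b) | b <- sort (fun b b' : D => le (val b) (val b')) (enum {: D})].

Definition descent (le : rel box) (T : filling) (i : nat) : bool :=
  [&& 0 < i, i < n & index i.+1 (rw le T) < index i (rw le T)]%N.

Definition ascent_at (le : rel box) (T : filling) (r s : nat) : bool :=
  [&& r < s, s < size (rw le T) &
      nth 0 (rw le T) s == (nth 0 (rw le T) r).+1]%N.

(* Meaningful when i is an ascent of T. *)
Definition attacking (TT : {set filling}) (T : filling) (i : nat) : bool :=
  swap i T \notin TT.

Definition ascent_compatible (le : rel box) (TT : {set filling}) : Prop :=
  forall (T T' : filling) (r s : nat), T \in TT -> T' \in TT ->
    ascent_at le T r s -> ascent_at le T' r s ->
    (attacking TT T (nth 0%N (rw le T) r) <->
     attacking TT T' (nth 0%N (rw le T') r)).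

(* The box containing i is in relation r with the box containing j.           *)
Definition entries_rel (r : rel box) (T : filling) (i j : nat) : bool :=
  [exists b : D, [exists b' : D,
    [&& val (T b) == i, val (T b') == j & r (val b) (val b')]]].

Section Modules.
Variable F : fieldType.

(* Vector space with basis all maps D -> {0, ..., n}; the F-span of a set TT  *)
(* of fillings is the subspace [span_of TT].                                  *)
Definition free_space := {ffun filling -> F^o}.

Definition basis_vec (T : filling) : free_space := [ffun X => (X == T)%:R].

Definition span_of (TT : {set filling}) : {vspace free_space} :=
  <<[seq basis_vec T | T <- enum TT]>>%VS.

Definition lin_ext (f : filling -> free_space) (v : free_space) : free_space :=
  \sum_(T : filling) (v T : F) *: f T.

Definition diagram_module (le : rel box) (TT : {set filling}) : op_space free_space :=
  OpSpace (span_of TT) (fun i => lin_ext (fun T =>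
    if descent le T i then - basis_vec T
    else if attacking TT T i then 0
    else basis_vec (swap i T))).

End Modules.
End Fillings.

Definition composition_of (n : nat) (alpha : seq nat) : bool :=
  all (fun a => 0 < a)%N alpha && (sumn alpha == n).

(* Row r.+1 starts in the column where row r ends, i.e. (alpha_r).-1 columns  *)
(* after the start of row r.                                                  *)
Definition row_start (alpha : seq nat) (r : nat) : nat :=
  sumn [seq a.-1 | a <- take r alpha].

Definition ribbon (alpha : seq nat) : {fset (nat * nat)} :=
  [fset b in [seq (r, c) | r <- iota 0 (size alpha),
                           c <- iota (row_start alpha r) (nth 0%N alpha r)]]%fset.

Definition Rib (n : nat) (alpha : seq nat) : {set filling n (ribbon alpha)} :=
  [set T | [&& standard T,
    [forall b, forall b',
       ((box_row (val b) == box_row (val b')) &&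
        (box_col (val b) < box_col (val b'))%N) ==>
         (T b < T b')%N] &
    [forall b, forall b',
       ((box_col (val b) == box_col (val b')) &&
        (box_row (val b') < box_row (val b))%N) ==>
         (T b < T b')%N]]].

Definition row_reading : rel box := fun b b' =>
  (box_row b < box_row b')%N ||
  ((box_row b == box_row b') && (box_col b <= box_col b')%N).

(* For standard T and 0 < i < n the last case means that i is strictly below  *)
(* i.+1.                                                                      *)
Definition Pmod (F : fieldType) (n : nat) (alpha : seq nat) :
    op_space (free_space n (ribbon alpha) F) :=
  OpSpace (span_of F (Rib n alpha)) (fun i => lin_ext (fun T =>
    if entries_rel (fun b b' => box_row b' < box_row b)%N T i i.+1
    then - basis_vec F T
    else if entries_rel (fun b b' => box_row b == box_row b') T i i.+1 then 0
    else basis_vec F (swap i T))).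

(* Main.v *)
(* Along the reading order rows come from bottom to top, and in a standard    *)
(* ribbon tableau an entry i.+1 in the row of i lies to the right of i; hence *)
(* i is a descent iff it is strictly above i.+1. An ascent i in the row of    *)
(* i.+1 is attacking. If i is strictly below i.+1, the two boxes cannot share *)
(* a column, so exchanging the entries i and i.+1 affects no row or column    *)
(* condition and i is nonattacking. Thus both actions agree on tableaux, and  *)
(* attacking ascents are recognized from their positions alone.               *)
Require Import Defs.
From HB Require Import structures.
From mathcomp Require Import all_boot all_order all_algebra.
From mathcomp Require Import perm.
From mathcomp Require Import finmap.
From mathcomp Require Import reals.
From mathcomp Require Import complex.
From mathcomp Require Import zify.

Set Implicit Arguments.
Unset Strict Implicit.
Unset Printing Implicit Defensive.

Import GRing.Theory.

(** Both actions are governed by the row word of a tableau T, which lists for k = 1, ..., n the row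
    of the box containing k ([entry_row]). On [Rib n alpha], comparing the letters at i and [i.+1]
    decides whether pi_i negates T, kills it or swaps two entries. This holds for the geometric rule
    ([Pmod_act_Rib]) and for the rule through the reading word ([descent_Rib], [attacking_Rib]), so
    the operators agree on a basis of the span. Swapping i and [i.+1] exchanges two letters of the
    row word and stays in [Rib n alpha] when i lies lower ([swap_Rib]). The 0-Hecke relations then
    reduce to finitely many relative orders of letters ([H0_module_swap]). Ascent compatibility
    holds because positions in the reading word determine boxes, hence rows ([ascent_boxes]). *)

(** * Adjacent transpositions of natural numbers *)

Definition transp (i k : nat) : nat :=
  if k == i then i.+1 else if k == i.+1 then i else k.

(** This form turns facts about [transp] into linear arithmetic for [lia]. *)
Lemma transp_cases i k : k = i /\ transp i k = i.+1 \/
  k = i.+1 /\ transp i k = i \/ k <> i /\ k <> i.+1 /\ transp i k = k.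
Proof.
rewrite /transp; case: eqP => [|neq_i]; first by left.
by case: eqP; right; [left|right].
Qed.

Lemma transpl i : transp i i = i.+1.
Proof. by have := transp_cases i i; lia. Qed.

Lemma transpr i : transp i i.+1 = i.
Proof. by have := transp_cases i i.+1; lia. Qed.

Lemma transp_id i k : (k < i) || (i.+1 < k) -> transp i k = k.
Proof. by have := transp_cases i k; lia. Qed.

Lemma transpK i : involutive (transp i).
Proof.
by move=> k; have := transp_cases i k; have := transp_cases i (transp i k); lia.
Qed.

Lemma transpC i j k :
  i.+1 < j -> transp i (transp j k) = transp j (transp i k).
Proof.
move=> ij; have := transp_cases i k; have := transp_cases j k.
have [kj|jk] := ltnP k j => jC iC.
  by rewrite (@transp_id j k) 1?(@transp_id j (transp i k)) //; lia.
by rewrite (@transp_id i k) 1?(@transp_id i (transp j k)) //; lia.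
Qed.

Lemma transp_braid i k :
  transp i (transp i.+1 (transp i k)) = transp i.+1 (transp i (transp i.+1 k)).
Proof.
have Si : transp i.+1 i = i by rewrite transp_id ?ltnS ?leqnn.
have SSi : transp i i.+2 = i.+2 by rewrite transp_id ?ltnS ?leqnn ?orbT.
have [->|neq_i] := eqVneq k i; first by rewrite Si !transpl SSi.
have [->|neq_iS] := eqVneq k i.+1.
  by rewrite transpr Si !transpl SSi transpr.
have [->|neq_iSS] := eqVneq k i.+2; first by rewrite SSi !transpr Si.
by rewrite !(@transp_id i k, @transp_id i.+1 k) //; lia.
Qed.

(** Exchanging two consecutive values inverts no pair but these two. *)
Lemma ltn_transp i j k :
  j < k -> ~~ ((j == i) && (k == i.+1)) -> transp i j < transp i k.
Proof. by have := transp_cases i j; have := transp_cases i k; lia. Qed.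

(** * Swapping entries of standard fillings, and row words *)

Section Swap.
Variables (n : nat) (D : {fset (nat * nat)}).
Implicit Types (T : filling n D) (i j : nat).

Lemma val_swap i T b : i < n -> val (swap i T b) = transp i (T b).
Proof.
move=> lin; rewrite /swap ffunE /transp.
case: tpermP => [->|->|/eqP + /eqP]; rewrite -?val_eqE /= ?inordK //; try lia.
- by rewrite eqxx.
- by do ?[case: eqP => ?]; lia.
- by move=> /negPf-> /negPf->.
Qed.

Lemma swapC i j T :
  i.+1 < j -> j < n -> swap i (swap j T) = swap j (swap i T).
Proof.
move=> ij jn; apply/ffunP => b; apply: val_inj.
have lin : i < n by lia.
by rewrite !val_swap // transpC.
Qed.

Lemma swap_braid i T : i.+1 < n ->
  swap i (swap i.+1 (swap i T)) = swap i.+1 (swap i (swap i.+1 T)).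
Proof.
move=> lin; apply/ffunP => b; apply: val_inj.
by rewrite !val_swap 1?transp_braid // ltnW.
Qed.

Lemma standard_inj T : standard T -> injective T.
Proof. by case/andP => /injectiveP. Qed.

Lemma standard_gt0 T b : standard T -> 0 < T b.
Proof. by case/andP => _ /forallP/(_ (T b)); rewrite codom_f => /eqP<-. Qed.

Lemma standard_exists T k :
  standard T -> 0 < k <= n -> exists b, val (T b) = k.
Proof.
move=> /andP[_ /forallP/(_ (inord k))] + /andP[k0 kn].
rewrite inordK ?k0 // => /eqP/codomP[b Tb].
by exists b; rewrite -Tb /= inordK.
Qed.

Lemma swap_standard i T : 0 < i < n -> standard T -> standard (swap i T).
Proof.
move=> /andP[i0 lin] sT; apply/andP; split.
  apply/injectiveP => b b' /(congr1 val); rewrite !val_swap //.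
  by move/(can_inj (transpK i))/val_inj/(standard_inj sT).
apply/forallP => k; apply/eqP; apply/idP/idP => [/codomP[b ->]|k0].
  have := standard_gt0 b sT.
  by have := transp_cases i (T b); rewrite val_swap //; lia.
have [|b Tb] := @standard_exists T (transp i k) sT.
  by move: (ltn_ord k) k0; have := transp_cases i k; lia.
by apply/codomP; exists b; apply: val_inj; rewrite val_swap // Tb transpK.
Qed.

(* Exactly one summand when T is standard and k is an entry. *)
Definition entry_row T k : nat :=
  \sum_(b : D | val (T b) == k) box_row (val b).

Lemma entry_rowE T b : standard T -> entry_row T (T b) = box_row (val b).
Proof.
move=> sT; rewrite /entry_row (eq_bigl (pred1 b)) ?big_pred1_eq // => b' /=.
by apply/eqP/eqP => [/val_inj/(standard_inj sT)|->].
Qed.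

(** As [transp i] is an involution, a box holding k after the swap held [transp i k] before it. *)
Lemma entry_row_swap i T k :
  i < n -> entry_row (swap i T) k = entry_row T (transp i k).
Proof.
move=> lin; apply: eq_bigl => b; rewrite val_swap //.
by apply/eqP/eqP => [<-|->]; rewrite transpK.
Qed.

Lemma entries_relE (r : rel box) T b b' : standard T ->
  entries_rel r T (T b) (T b') = r (val b) (val b').
Proof.
move=> sT; apply/existsP/idP => [[c /existsP[c']]|rbb'].
  case/and3P => /eqP/val_inj/(standard_inj sT)->.
  by move=> /eqP/val_inj/(standard_inj sT)->.
by exists b; apply/existsP; exists b'; rewrite !eqxx.
Qed.

End Swap.

(** * Linear extension of maps on fillings, and the 0-Hecke relations *)

Section LinExt.
Variables (n : nat) (D : {fset (nat * nat)}) (F : fieldType).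
Local Notation V := (free_space n D F).
Implicit Types (f g : filling n D -> V) (TT : {set filling n D}).
Local Open Scope ring_scope.

Lemma lin_ext_is_linear f : linear (lin_ext f).
Proof.
move=> a u v; rewrite /lin_ext scaler_sumr -big_split /=.
by apply: eq_bigr => T _; rewrite !ffunE scalerDl scalerA.
Qed.

HB.instance Definition _ f :=
  GRing.isLinear.Build F V V *:%R (lin_ext f) (lin_ext_is_linear f).

Lemma lin_ext_basis f T : lin_ext f (basis_vec F T) = f T.
Proof.
rewrite /lin_ext (bigD1 T) //= ffunE eqxx scale1r big1 ?addr0 // => T' neqT.
by rewrite ffunE (negPf neqT) scale0r.
Qed.

Lemma lin_ext_comp f (h : {linear V -> V}) v :
  h (lin_ext f v) = lin_ext (h \o f) v.
Proof.
by rewrite /lin_ext raddf_sum; apply: eq_bigr => T _; rewrite /= linearZ.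
Qed.

Lemma lin_ext_opp f v : lin_ext f (- v) = - lin_ext f v.
Proof. exact: linearN. Qed.

Lemma lin_extN f v : - lin_ext f v = lin_ext (fun T => - f T) v.
Proof. by rewrite /lin_ext -sumrN; apply: eq_bigr => T _; rewrite scalerN. Qed.

Lemma mem_basis_vec TT T : T \in TT -> basis_vec F T \in span_of F TT.
Proof. by move=> TTT; apply: memv_span; rewrite map_f ?mem_enum. Qed.

(** Every generator of the span vanishes at a filling outside [TT]; thus the sum defining [lin_ext]
    only sees [TT]. *)
Lemma span_of_eq0 TT (v : V) T : v \in span_of F TT -> T \notin TT -> v T = 0.
Proof.
(* The generating list is presented as a tuple so that [coord_span] applies. *)
rewrite -[span_of F TT]/(<<in_tuple [seq basis_vec F T | T <- enum TT]>>%VS).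
move=> /coord_span-> TNTT; rewrite sum_ffunE big1 // => i _.
set w := (in_tuple _)`_i.
have /mapP[T' T'TT wE] : w \in [seq basis_vec F T | T <- enum TT].
  exact: mem_nth.
rewrite mem_enum in T'TT.
by rewrite ffunE wE ffunE; case: eqP TNTT => [->|]; rewrite ?T'TT // scaler0.
Qed.

Lemma eq_in_lin_ext TT f g v : {in TT, f =1 g} ->
  v \in span_of F TT -> lin_ext f v = lin_ext g v.
Proof.
move=> fg vTT; apply: eq_bigr => T _.
case: (boolP (T \in TT)) => [/fg-> //|/(span_of_eq0 vTT)->].
by rewrite !scale0r.
Qed.

Lemma lin_ext_mem TT f v : {in TT, forall T, f T \in span_of F TT} ->
  v \in span_of F TT -> lin_ext f v \in span_of F TT.
Proof.
move=> fTT vTT; apply: memv_suml => T _.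
case: (boolP (T \in TT)) => [/fTT fT|/(span_of_eq0 vTT)->].
  exact: memvZ.
by rewrite scale0r mem0v.
Qed.

Ltac mem_swap swapTT rows := solve
  [ assumption
  | apply swapTT; [assumption | mem_swap swapTT rows | by rewrite ?rows] ].

(** Evaluates a word in the operators on a basis vector: [rows] pulls each row comparison back to
    the initial filling, where the case hypotheses settle it. *)
Ltac H0_eval act act_gt act_eq act_lt swapTT rows :=
  let row_order := (by rewrite ?rows) in
  let mem := mem_swap swapTT rows in
  repeat first
    [ rewrite lin_ext_basis | rewrite lin_ext_opp | rewrite linear0
    | rewrite opprK | rewrite oppr0 | progress simpl
    | match goal with |- context [act ?i ?T] =>
        first [ rewrite (act_gt i T); [|row_order|assumption|mem]
              | rewrite (act_eq i T); [|row_order|assumption|mem]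
              | rewrite (act_lt i T); [|row_order|assumption|mem] ]
      end ].

(* Since swap i acts on the row words k |-> entry_row T k by exchanging       *)
(* letters, the 0-Hecke relations on a filling T only involve the relative    *)
(* order of two, three or four letters of its row word.                       *)
Lemma H0_module_swap TT (act : nat -> filling n D -> V) :
  (forall i T, (0 < i < n)%N -> T \in TT ->
     (entry_row T i < entry_row T i.+1)%N -> swap i T \in TT) ->
  (forall i T, (0 < i < n)%N -> T \in TT ->
     act i T = if (entry_row T i.+1 < entry_row T i)%N then - basis_vec F T
               else if entry_row T i == entry_row T i.+1 then 0
               else basis_vec F (swap i T)) ->
  is_H0_module n (OpSpace (span_of F TT) (fun i => lin_ext (act i))).
Proof.
move=> swapTT actE.
have act_gt i T : (entry_row T i.+1 < entry_row T i)%N ->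
    (0 < i < n)%N -> T \in TT -> act i T = - basis_vec F T.
  by move=> lt_i i0n TTT; rewrite actE // lt_i.
have act_eq i T : entry_row T i = entry_row T i.+1 ->
    (0 < i < n)%N -> T \in TT -> act i T = 0.
  by move=> eq_i i0n TTT; rewrite actE // eq_i ltnn eqxx.
have act_lt i T : (entry_row T i < entry_row T i.+1)%N ->
    (0 < i < n)%N -> T \in TT -> act i T = basis_vec F (swap i T).
  by move=> lt_i i0n TTT; rewrite actE // ltnNge ltnW //= ltn_eqF.
split=> /=.
- move=> i v i0n; apply: lin_ext_mem => T TTT; rewrite actE //.
  case: ltngtP => [lt_i|lt_i|_]; rewrite ?memvN ?mem0v ?mem_basis_vec //.
  exact: swapTT.
- by move=> i a u v *; rewrite linearP.
- move=> i v i0n vTT; have lin : (i < n)%N by lia.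
  rewrite lin_ext_comp lin_extN; apply: eq_in_lin_ext vTT => T TTT /=.
  case: (ltngtP (entry_row T i) (entry_row T i.+1)) => [lt_i|lt_i|eq_i].
  + rewrite act_lt // lin_ext_basis act_gt ?swapTT //.
    by rewrite !entry_row_swap // transpl transpr.
  + by rewrite act_gt // lin_ext_opp lin_ext_basis act_gt.
  + by rewrite act_eq // linear0 oppr0.
- move=> i j v i0 ij jn vTT; rewrite !lin_ext_comp.
  apply: eq_in_lin_ext vTT => T TTT /=.
  have lin : (i < n)%N by lia.
  have i0n : (0 < i < n)%N by lia.
  have j0n : (0 < j < n)%N by lia.
  have rowi (T' : filling n D) k :
      entry_row (swap i T') k = entry_row T' (transp i k).
    exact: entry_row_swap.
  have rowj (T' : filling n D) k :
      entry_row (swap j T') k = entry_row T' (transp j k).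
    exact: entry_row_swap.
  have [ij0 ij1] : transp i j = j /\ transp i j.+1 = j.+1.
    by rewrite !transp_id //; lia.
  have [ji0 ji1] : transp j i = i /\ transp j i.+1 = i.+1.
    by rewrite !transp_id //; lia.
  have rows := (rowi, rowj, ij0, ij1, ji0, ji1).
  (* The two pairs of letters are disjoint, so neither swap changes the comparison made by the other
     operator. *)
  case: (ltngtP (entry_row T i) (entry_row T i.+1)) => ord_i;
  case: (ltngtP (entry_row T j) (entry_row T j.+1)) => ord_j;
  H0_eval act act_gt act_eq act_lt swapTT rows; by rewrite 1?swapC.
- move=> i v i0 lin vTT; rewrite !lin_ext_comp.
  apply: eq_in_lin_ext vTT => T TTT /=.
  have lin' : (i < n)%N by lia.
  have i0n : (0 < i < n)%N by lia.
  have j0n : (0 < i.+1 < n)%N by lia.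
  have Si : transp i.+1 i = i by rewrite transp_id ?ltnS ?leqnn.
  have SSi : transp i i.+2 = i.+2 by rewrite transp_id ?ltnS ?leqnn ?orbT.
  have rowi (T' : filling n D) k :
      entry_row (swap i T') k = entry_row T' (transp i k).
    exact: entry_row_swap.
  have rowSi (T' : filling n D) k :
      entry_row (swap i.+1 T') k = entry_row T' (transp i.+1 k).
    exact: entry_row_swap.
  have rows := (rowi, rowSi, Si, SSi, transpl, transpr).
  (* Only the thirteen weak orders of three letters survive [lia]; for strictly increasing letters
     both sides are triple swaps, equal by [swap_braid]. *)
  case: (ltngtP (entry_row T i) (entry_row T i.+1)) => ord_1;
  case: (ltngtP (entry_row T i.+1) (entry_row T i.+2)) => ord_2;
  case: (ltngtP (entry_row T i) (entry_row T i.+2)) => ord_3; try lia;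
  H0_eval act act_gt act_eq act_lt swapTT rows; by rewrite 1?swap_braid.
Qed.

End LinExt.

(** * The row reading order and positions in the reading word *)

Lemma box_inj (b b' : box) : box_row b = box_row b' -> box_col b = box_col b' ->
  b = b'.
Proof. by case: b b' => [r c] [r' c'] /= -> ->. Qed.

Lemma row_reading_trans : transitive row_reading.
Proof. by move=> [r c] [r' c'] [r'' c'']; rewrite /row_reading /=; lia. Qed.

Lemma row_reading_refl : reflexive row_reading.
Proof. by move=> b; rewrite /row_reading eqxx leqnn orbT. Qed.

Lemma row_reading_total : total row_reading.
Proof. by move=> [r c] [r' c']; rewrite /row_reading /=; lia. Qed.

Section Reading.
Variables (n : nat) (D : {fset (nat * nat)}).
Implicit Types (T : filling n D) (b : D).

Definition reading : seq D :=
  sort (fun b b' => row_reading (val b) (val b')) (enum {: D}).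

Let le_trans : transitive (fun b b' : D => row_reading (val b) (val b')).
Proof. by move=> b b' b''; apply: row_reading_trans. Qed.

Let le_refl : reflexive (fun b b' : D => row_reading (val b) (val b')).
Proof. by move=> b; apply: row_reading_refl. Qed.

Lemma reading_sorted :
  sorted (fun b b' => row_reading (val b) (val b')) reading.
Proof. by apply: sort_sorted => b b'; apply: row_reading_total. Qed.

Lemma mem_reading b : b \in reading.
Proof. by rewrite mem_sort mem_enum. Qed.

Lemma index_rw T b :
  standard T -> index (val (T b)) (rw row_reading T) = index b reading.
Proof.
move=> sT; rewrite /rw; apply: (@index_map _ _ (fun b => val (T b))).
by move=> c c' /val_inj/(standard_inj sT).
Qed.

Lemma reading_index_lt b b' :
  index b reading < index b' reading -> row_reading (val b) (val b').
Proof.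
by apply: (sorted_ltn_index le_trans reading_sorted); apply: mem_reading.
Qed.

Lemma reading_index_le b b' :
  index b reading <= index b' reading -> row_reading (val b) (val b').
Proof.
by apply: (sorted_leq_index le_trans le_refl reading_sorted);
  apply: mem_reading.
Qed.

(** The sorted list of boxes does not depend on the filling, so the boxes at positions r and s can
    be chosen before [T']. *)
Lemma ascent_boxes T r s : ascent_at row_reading T r s ->
  exists b b' : D, row_reading (val b) (val b') /\
    forall T', nth 0 (rw row_reading T') r = val (T' b) /\
               nth 0 (rw row_reading T') s = val (T' b').
Proof.
case/and3P => rs s_lt _.
have s_size : s < size reading by rewrite -(size_map (fun b => val (T b))).
have r_size := ltn_trans rs s_size.
(* [nth] needs a default box; the bound on s provides one. *)
have [b0 _] : exists b0 : D, b0 \in reading.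
  by case: reading s_size => // b0 ? _; exists b0; rewrite mem_head.
exists (nth b0 reading r), (nth b0 reading s); split.
  by apply: (sorted_leq_nth le_trans le_refl b0 reading_sorted) => //;
    apply: ltnW.
by move=> T'; rewrite /rw -/reading !(nth_map b0).
Qed.

End Reading.

(** * Descents and attacking ascents of standard ribbon tableaux *)

Section Ribbon.
Variables (n : nat) (alpha : seq nat).
Local Notation D := (ribbon alpha).
Implicit Types (T : filling n D) (b : D).

Lemma RibP T : reflect
  [/\ standard T,
      forall b b', box_row (val b) = box_row (val b') ->
        box_col (val b) < box_col (val b') -> T b < T b' &
      forall b b', box_col (val b) = box_col (val b') ->
        box_row (val b') < box_row (val b) -> T b < T b']
  (T \in Rib n alpha).
Proof.
rewrite inE; apply: (iffP and3P) => -[sT rowT colT]; split=> //.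
- move=> b b' rowE colL; move/forallP/(_ b)/forallP/(_ b'): rowT.
  by rewrite rowE eqxx colL.
- move=> b b' colE rowL; move/forallP/(_ b)/forallP/(_ b'): colT.
  by rewrite colE eqxx rowL.
- apply/forallP => b; apply/forallP => b'; apply/implyP => /andP[/eqP].
  exact: rowT.
- apply/forallP => b; apply/forallP => b'; apply/implyP => /andP[/eqP].
  exact: colT.
Qed.

Lemma Rib_standard T : T \in Rib n alpha -> standard T.
Proof. by case/RibP. Qed.

(** Each row or column condition puts the larger entry in a weakly lower row, whereas [i.+1] lies
    strictly above i; so the inequality reversed by the swap is none of them. *)
Lemma swap_Rib i T : 0 < i < n -> T \in Rib n alpha ->
  entry_row T i < entry_row T i.+1 -> swap i T \in Rib n alpha.
Proof.
move=> i0n /RibP[sT rowT colT] lt_i; have /andP[_ lin] := i0n.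
have swapL b b' : box_row (val b') <= box_row (val b) -> T b < T b' ->
    swap i T b < swap i T b'.
  move=> le_row lt_T; have /= := (val_swap T b lin, val_swap T b' lin).
  case=> -> ->; apply: ltn_transp => //; apply/andP => -[/eqP Tb /eqP Tb'].
  by move: lt_i; rewrite -Tb' -Tb !entry_rowE // ltnNge le_row.
apply/RibP; split; first exact: swap_standard.
- by move=> b b' rowE /(rowT _ _ rowE); apply: swapL; rewrite rowE.
- by move=> b b' colE rowL; apply: swapL (ltnW rowL) (colT _ _ colE rowL).
Qed.

Lemma Rib_same_row T b b' : T \in Rib n alpha ->
  box_row (val b) = box_row (val b') -> T b < T b' ->
  box_col (val b) < box_col (val b').
Proof.
move=> /RibP[_ rowT _] rowE; 
  case: (ltngtP (box_col (val b))) => // [/(rowT _ _ (esym rowE))|colE].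
  by case: ltngtP.
by rewrite (_ : b = b') ?ltnn //; apply/val_inj/box_inj.
Qed.

Lemma swap_notin_Rib i T : 0 < i < n -> T \in Rib n alpha ->
  entry_row T i = entry_row T i.+1 -> swap i T \notin Rib n alpha.
Proof.
move=> /andP[i0 lin] TR; have sT := Rib_standard TR.
have [|b /= Tb] := @standard_exists _ _ T i sT; first by lia.
have [|b' /= Tb'] := @standard_exists _ _ T i.+1 sT; first by lia.
rewrite -[in X in X = _]Tb -Tb' !entry_rowE // => rowE.
have colL : box_col (val b) < box_col (val b').
  by apply: (Rib_same_row TR) => //; rewrite Tb Tb'.
apply/negP => /RibP[_ /(_ b b' rowE colL) + _].
have /= := (val_swap T b lin, val_swap T b' lin) => -[-> ->].
by rewrite Tb Tb' transpl transpr ltnNge leqnSn.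
Qed.

Lemma attacking_Rib i T : 0 < i < n -> T \in Rib n alpha ->
  entry_row T i <= entry_row T i.+1 ->
  attacking (Rib n alpha) T i = (entry_row T i == entry_row T i.+1).
Proof.
move=> i0n TR; rewrite leq_eqVlt => /predU1P[eq_i|lt_i].
  by rewrite eq_i eqxx; apply: swap_notin_Rib.
by rewrite ltn_eqF // /attacking swap_Rib.
Qed.

Lemma descent_Rib i T : 0 < i < n -> T \in Rib n alpha ->
  descent row_reading T i = (entry_row T i.+1 < entry_row T i).
Proof.
move=> i0n TR; rewrite /descent andbA i0n /=; have sT := Rib_standard TR.
have [|b /= Tb] := @standard_exists _ _ T i sT; first by lia.
have [|b' /= Tb'] := @standard_exists _ _ T i.+1 sT; first by lia.
rewrite -Tb' -[in index i]Tb -[in entry_row T i]Tb !index_rw // !entry_rowE //.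
(* Boxes in distinct rows are read in the order of their rows; in a common row [i.+1] would have to
   be left of i, against [Rib_same_row]. *)
apply/idP/idP => [/reading_index_lt/orP[//|/andP[/eqP rowE colL]]|rowL].
  have := Rib_same_row TR (esym rowE).
  by rewrite Tb Tb' ltnSn ltnNge colL => /(_ isT).
rewrite ltnNge; apply/negP => /reading_index_le/orP[rowL'|/andP[/eqP rowE]].
  by rewrite ltnNge ltnW in rowL.
by rewrite rowE ltnn in rowL.
Qed.

(** An ascent is attacking exactly when the boxes at its two positions share a row, a condition
    independent of the tableau. *)
Lemma ascent_compatible_Rib : ascent_compatible row_reading (Rib n alpha).
Proof.
move=> T T' r s TR T'R /[dup]/ascent_boxes[b [b' [le_bb' nthE]]].
have attackE T1 : T1 \in Rib n alpha -> ascent_at row_reading T1 r s ->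
    attacking (Rib n alpha) T1 (nth 0 (rw row_reading T1) r) =
      (box_row (val b) == box_row (val b')).
  move=> T1R /and3P[_ _ /eqP]; have [-> ->] := nthE T1 => TbS.
  have sT1 := Rib_standard T1R.
  have rows : entry_row T1 (T1 b).+1 = box_row (val b').
    by rewrite -TbS entry_rowE.
  rewrite attacking_Rib ?rows ?entry_rowE //.
    by move: (standard_gt0 b sT1) (ltn_ord (T1 b')); rewrite /= in TbS *; lia.
  by case/orP: le_bb' => [/ltnW|/andP[/eqP->]].
by move=> asc asc'; rewrite !attackE.
Qed.

(** * Existence of a standard ribbon tableau *)

Lemma card_ribbon : #|{: D}| = sumn alpha.
Proof.
rewrite -cardfE card_fseq undup_id.
  rewrite size_allpairs_dep (eq_map (fun r => size_iota _ (nth 0 alpha r))).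
  by rewrite map_nth_iota0 // take_size.
apply: allpairs_uniq_dep; [exact: iota_uniq|by move=> r _; exact: iota_uniq|].
by move=> [r c] [r' c'] _ _ /= [-> ->].
Qed.

(* Witness: number the boxes row by row from the top, left to right.          *)
Lemma Rib_neq0 : sumn alpha = n -> Rib n alpha != set0.
Proof.
move=> sum_alpha.
pose le (b b' : D) := (box_row (val b') < box_row (val b)) ||
  ((box_row (val b) == box_row (val b')) &&
   (box_col (val b) <= box_col (val b'))).
(* Reflexivity of [le] makes a box count itself, so ranks start at 1. *)
pose rank b := #|[set b' | le b' b]|.
have le_refl b : le b b by rewrite /le eqxx leqnn orbT.
have le_trans b b' b'' : le b b' -> le b' b'' -> le b b''.
  rewrite /le; move: (val b) (val b') (val b'') => [r c] [r' c'] [r'' c''] /=.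
  lia.
have rank_lt b b' : le b b' -> b != b' -> rank b < rank b'.
  move=> le_bb' neq_b; apply/proper_card/properP; split.
    by apply/subsetP => b''; rewrite !inE => /le_trans; apply.
  exists b'; rewrite !inE ?le_refl //; apply: contra neq_b => le_b'b.
  apply/eqP/val_inj/box_inj; move: le_bb' le_b'b; rewrite /le;
  move: (val b) (val b') => [r c] [r' c'] /=; lia.
have rank_gt0 b : 0 < rank b.
  by apply/card_gt0P; exists b; rewrite inE.
have rank_le b : rank b <= n by rewrite -sum_alpha -card_ribbon max_card.
pose T : filling n D := [ffun b => inord (rank b)].
have TE b : T b = rank b :> nat by rewrite ffunE inordK // ltnS.
have T_inj : injective T.
  move=> b b' /(congr1 val); rewrite /= !TE => eq_rank.
  apply/eqP/negPn/negP => neq_b.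
  have [le_bb'|le_b'b] : le b b' \/ le b' b.
    by rewrite /le; move: (val b) (val b') => [r c] [r' c'] /=; lia.
  - by move: (rank_lt _ _ le_bb' neq_b); rewrite eq_rank ltnn.
  - by rewrite eq_sym in neq_b; move: (rank_lt _ _ le_b'b neq_b);
       rewrite eq_rank ltnn.
apply/set0Pn; exists T; apply/RibP; split.
- apply/andP; split; first exact/injectiveP.
  (* Surjectivity onto 1, ..., n by counting: the image avoids 0 and, T being injective, has n
     elements. *)
  have codomE : [set k in codom T] = [set~ ord0].
    apply/eqP; rewrite eqEcard cardsC1 card_ord /=; apply/andP; split.
      apply/subsetP => k; rewrite !inE => /codomP[b ->].
      by rewrite -val_eqE /= TE -lt0n.
    by rewrite cardsE card_codom // card_ribbon sum_alpha.
  apply/forallP => k; move/setP/(_ k): codomE; rewrite !inE => ->.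
  by rewrite -val_eqE /= lt0n.
- move=> b b' rowE colL; rewrite !TE; apply: rank_lt.
    by rewrite /le rowE eqxx (ltnW colL) orbT.
  by apply: contraTneq colL => ->; rewrite ltnn.
- move=> b b' colE rowL; rewrite !TE; apply: rank_lt.
    by rewrite /le rowL.
  by apply: contraTneq rowL => ->; rewrite ltnn.
Qed.

(** Each of i and [i.+1] occupies a single box, so the existential tests compare the rows of these
    two boxes. *)
Lemma Pmod_act_Rib (F : fieldType) i T : 0 < i < n -> T \in Rib n alpha ->
  (if entries_rel (fun b b' : box => box_row b' < box_row b)%N T i i.+1
   then - basis_vec F T
   else if entries_rel (fun b b' : box => box_row b == box_row b') T i i.+1
   then 0
   else basis_vec F (swap i T))%R =
  (if (entry_row T i.+1 < entry_row T i)%N then - basis_vec F T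
   else if entry_row T i == entry_row T i.+1 then 0
   else basis_vec F (swap i T))%R.
Proof.
move=> i0n /Rib_standard sT.
have [|b /= Tb] := @standard_exists _ _ T i sT; first by lia.
have [|b' /= Tb'] := @standard_exists _ _ T i.+1 sT; first by lia.
have relE r : entries_rel r T i i.+1 = r (val b) (val b').
  by rewrite -(entries_relE r b b' sT) Tb Tb'.
have := (entry_rowE b sT, entry_rowE b' sT); rewrite Tb Tb' => -[-> ->].
by rewrite !relE.
Qed.

End Ribbon.

Theorem theorem7p10 (R : realType) (n : nat) (alpha : seq nat)
    (Halpha : composition_of n alpha) :
  [/\ Rib n alpha != set0,
      ascent_compatible row_reading (Rib n alpha),
      is_H0_module n (Pmod R[i]%C n alpha) &
      same_H0_module n (Pmod R[i]%C n alpha) (diagram_module R[i]%C row_reading (Rib n alpha))].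
Proof.
have /andP[_ /eqP sum_alpha] := Halpha.
split; first exact: Rib_neq0.
- exact: ascent_compatible_Rib.
- apply: H0_module_swap; first by move=> i T; apply: swap_Rib.
  by move=> i T; apply: Pmod_act_Rib.
- split=> // i v i0n; apply: eq_in_lin_ext => T TR.
  rewrite Pmod_act_Rib // descent_Rib //.
  (* Off the descents [attacking_Rib] applies and turns the attacking test into equality of rows. *)
  by case: ltnP => // le_i; rewrite attacking_Rib.
Qed.
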